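(* Let $G$ be a self-similar group of degree $m$ and orbit-type $(m_1,\dots,m_s)$. Then the following hold. 1) The restricted direct product $G^{(\omega)}$ of countably infinitely many copies of $G$ admits a faithful state-closed representation of degree $m+1$ and orbit-type $(m_1,\dots,m_s,1)$. In particular, for $G=\mathbb{Z}$, the group $\mathbb{Z}^{(\omega)}$ admits a faithful state-closed representation of orbit-type $(2,1)$ which is in addition finite-state. 2) Let $K$ be a regular subgroup of $\mathrm{Sym}(\{1,\dots,s\})$. Then the restricted wreath product $G\wr K$ admits a faithful state-closed representation of degree $(m_1\cdot m_2\cdots m_s)\cdot s$. In particular, the group $(\mathbb{Z}\wr\mathbb{Z})\wr C_2$ is finite-state and self-similar of degree $4$ (i.e. it admits a faithful state-closed representation of degree $4$ which is finite-state).
   Context: For a finite set $Y$ of size $m\ge1$, $\mathcal{T}_m=\mathcal{T}(Y)$ is the rooted $m$-tree of finite strings over $Y$ and $\mathcal{A}_m=\mathcal{A}(Y)$ its automorphism group. Each $\alpha\in\mathcal{A}_m$ is written $\alpha=(\alpha_y\mid y\in Y)\sigma(\alpha)$ with $\sigma(\alpha)\in\mathrm{Sym}(Y)$ its action on the first level and states $\alpha_y\in\mathcal{A}_m$ given by $(yu)^\alpha=y^{\sigma(\alpha)}u^{\alpha_y}$. $Q(\alpha)$, the set of states of $\alpha$, consists of $\alpha$ and all elements obtained by repeatedly passing to states; $\alpha$ is finite-state if $Q(\alpha)$ is finite. A subgroup of $\mathcal{A}_m$ is state-closed if it contains $Q(\alpha)$ for each of its elements $\alpha$. A state-closed representation of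 degree $m$ of a group $G$ is a homomorphism $G\to\mathcal{A}_m$ with state-closed image; it is finite-state if every element of the image is finite-state. Its orbit-type is $(m_1,\dots,m_s)$ if the image has exactly $s$ orbits on the first level $Y$, of sizes $m_1,\dots,m_s$ (so $m=m_1+\dots+m_s$; transitivity is not required). $G$ is self-similar of degree $m$ and orbit-type $(m_1,\dots,m_s)$ if it admits a faithful state-closed representation of that degree and orbit-type. A regular subgroup of $\mathrm{Sym}(\{1,\dots,s\})$ is a transitive subgroup with trivial point stabilizers; $G\wr K=G^s\rtimes K$ with $K$ permuting the coordinates. More generally, $A\wr U$ is the restricted wreath product $\big(\bigoplus_{u\in U}A\big)\rtimes U$. $C_2$ is the group of order 2. *)

(* Defs.v *)
From HB Require Import structures.
From mathcomp Require Import all_boot all_fingroup all_algebra.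
From mathcomp Require Import finmap.
From mathcomp Require Import boolp classical_sets cardinality.

Set Implicit Arguments.
Unset Strict Implicit.
Unset Printing Implicit Defensive.

Import GroupScope.

(* Vertices of the tree are the strings over [Y]; the children of [u] are the
   strings [rcons u y]. *)
Definition tree_edge (Y : Type) (u v : seq Y) : Prop :=
  exists y, v = rcons u y.

(* Edges are directed away from the root.  The inverse is stored as data so
   that the group inverse needs no choice. *)
Record tree_aut (Y : Type) := TreeAut {
  aut_fun :> seq Y -> seq Y;
  aut_inv : seq Y -> seq Y;
  aut_funK : cancel aut_fun aut_inv;
  aut_invK : cancel aut_inv aut_fun;
  aut_root : aut_fun [::] = [::];
  aut_edge : forall u v, tree_edge u v <-> tree_edge (aut_fun u) (aut_fun v)
}.

HB.instance Definition _ (Y : Type) := gen_eqMixin (tree_aut Y).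
HB.instance Definition _ (Y : Type) := gen_choiceMixin (tree_aut Y).

Section TreeAut.
Variable Y : Type.
Implicit Types (a b c : tree_aut Y) (u v : seq Y).

Lemma tree_autP a b : a =1 b -> a = b.
Proof.
case: a b => [f f' fK f'K f0 fe] [g g' gK g'K g0 ge] /= fg.
have {}fg : f = g by apply: funext.
subst g; have fg' : f' = g' by apply: funext => u; rewrite -{1}(g'K u) fK.
by subst g'; congr TreeAut; apply: Prop_irrelevance.
Qed.

Fact aut_one_edge u v : tree_edge u v <-> tree_edge (id u) (id v).
Proof. by []. Qed.

Definition aut_one :=
  @TreeAut Y id id (frefl _) (frefl _) (erefl _) aut_one_edge.

(* Automorphisms act on the right: in [a * b], [a] acts first. *)
Fact aut_mul_root a b : b (a [::]) = [::].
Proof. by rewrite !aut_root. Qed.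

Fact aut_mul_edge a b u v :
  tree_edge u v <-> tree_edge ((b \o a) u) ((b \o a) v).
Proof. by rewrite (aut_edge a) (aut_edge b). Qed.

Definition aut_mul a b :=
  @TreeAut Y (b \o a) (aut_inv a \o aut_inv b)
    (can_comp (aut_funK b) (aut_funK a)) (can_comp (aut_invK a) (aut_invK b))
    (aut_mul_root a b) (aut_mul_edge a b).

Fact aut_inv_root a : aut_inv a [::] = [::].
Proof. by rewrite -{1}(aut_root a) aut_funK. Qed.

Fact aut_inv_edge a u v :
  tree_edge u v <-> tree_edge (aut_inv a u) (aut_inv a v).
Proof. by rewrite (aut_edge a (aut_inv a u)) !aut_invK. Qed.

Definition aut_invg a :=
  @TreeAut Y (aut_inv a) a (aut_invK a) (aut_funK a) (aut_inv_root a)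
    (@aut_inv_edge a).

Fact aut_mulA : associative aut_mul.
Proof. by move=> a b c; apply: tree_autP. Qed.
Fact aut_mul1 : left_id aut_one aut_mul.
Proof. by move=> a; apply: tree_autP. Qed.
Fact aut_1mul : right_id aut_one aut_mul.
Proof. by move=> a; apply: tree_autP. Qed.
Fact aut_mulV : left_inverse aut_one aut_invg aut_mul.
Proof. by move=> a; apply: tree_autP => u; exact: aut_invK. Qed.
Fact aut_Vmul : right_inverse aut_one aut_invg aut_mul.
Proof. by move=> a; apply: tree_autP => u; exact: aut_funK. Qed.

HB.instance Definition _ :=
  isGroup.Build (tree_aut Y) aut_mulA aut_mul1 aut_1mul aut_mulV aut_Vmul.

Lemma aut_rcons a u y : exists z, a (rcons u y) = rcons (a u) z.
Proof. by case: (aut_edge a u (rcons u y)) => + _; apply; exists y. Qed.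

Definition level1 a y : Y := head y (a [:: y]).
Definition state_fun a y u : seq Y := behead (a (y :: u)).

Lemma autE a y u : a (y :: u) = level1 a y :: state_fun a y u.
Proof.
suff [v av] : exists v, a (y :: u) = level1 a y :: v by rewrite /state_fun av.
rewrite /level1; have [z az] := aut_rcons a [::] y.
rewrite aut_root /= in az; rewrite az /=.
elim/last_ind: u => [|u x [v IH]]; first by exists [::].
have [t] := aut_rcons a (y :: u) x.
by rewrite rcons_cons IH => ->; exists (rcons v t).
Qed.

Fact level1K a : cancel (level1 a) (level1 (aut_invg a)).
Proof.
move=> y; have := aut_funK a [:: y]; rewrite autE.
by rewrite -[aut_inv a _]/(aut_invg a _) autE => -[].
Qed.

Lemma level1_inj a : injective (level1 a).
Proof. exact: can_inj (@level1K a). Qed.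

Fact state_funK a y :
  cancel (state_fun a y) (state_fun (aut_invg a) (level1 a y)).
Proof.
move=> u; have := aut_funK a (y :: u); rewrite autE.
by rewrite -[aut_inv a _]/(aut_invg a _) autE => -[].
Qed.

Fact state_invK a y :
  cancel (state_fun (aut_invg a) (level1 a y)) (state_fun a y).
Proof.
move=> u; have := state_funK (aut_invg a) (level1 a y) u.
rewrite level1K; congr (_ = _); rewrite /state_fun; congr (behead _).
Qed.

Fact state_root a y : state_fun a y [::] = [::].
Proof.
rewrite /state_fun; have [z] := aut_rcons a [::] y.
by rewrite aut_root /= => ->.
Qed.

Fact state_edge a y u v :
  tree_edge u v <-> tree_edge (state_fun a y u) (state_fun a y v).
Proof.
have consE (x : Y) (s t : seq Y) :
    tree_edge s t <-> tree_edge (x :: s) (x :: t).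
  by split=> -[z]; [move=> ->; exists z | move=> -[->]; exists z].
by rewrite (consE y) (aut_edge a) !autE -consE.
Qed.

(* The state a_y, determined by (y u)^a = y^sigma(a) u^(a_y); see [autE]. *)
Definition state a y : tree_aut Y :=
  TreeAut (@state_funK a y) (@state_invK a y) (state_root a y)
    (@state_edge a y).

Inductive is_state a : tree_aut Y -> Prop :=
  | is_state_refl : is_state a a
  | is_state_step b y : is_state a b -> is_state a (state b y).

Definition states a : set (tree_aut Y) := [set b | is_state a b]%classic.

Definition finite_state a : Prop := finite_set (states a).

Definition state_closed (H : set (tree_aut Y)) : Prop :=
  forall a, H a -> (states a `<=` H)%classic.

End TreeAut.

Definition sigma (Y : finType) (a : tree_aut Y) : {perm Y} :=
  perm (@level1_inj Y a).

Lemma aut_consE (Y : finType) (a : tree_aut Y) (y : Y) (u : seq Y) :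
  a (y :: u) = sigma a y :: state a y u.
Proof. by rewrite permE autE. Qed.

Section Representations.
Variables (G : groupType) (Y : finType).
Implicit Type rho : {multiplicative G -> tree_aut Y}.

Definition state_closed_rep rho : Prop := state_closed (range rho).

Definition faithful_state_closed_rep rho : Prop :=
  injective rho /\ state_closed_rep rho.

Definition finite_state_rep rho : Prop := forall g, finite_state (rho g).

(* The permutation group induced on the first level by the image of [rho]. *)
Definition level1_image rho : {set {perm Y}} :=
  [set p | `[< exists g, sigma (rho g) = p >]].

Definition level1_orbits rho : {set {set Y}} :=
  [set orbit 'P (level1_image rho) y | y in [set: Y]].

(* Orbit-types are taken up to reordering of the orbits. *)
Definition orbit_type rho (ms : seq nat) : Prop :=
  perm_eq [seq #|B| | B : {set Y} <- enum (level1_orbits rho)] ms.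

End Representations.

(* The alphabet of size [m] is taken to be ['I_m]. *)
Definition self_similar (G : groupType) (m : nat) (ms : seq nat) : Prop :=
  exists rho : {multiplicative G -> tree_aut 'I_m},
    faithful_state_closed_rep rho /\ orbit_type rho ms.

(* Restricted direct product of copies of [G] indexed by [I]. *)
Definition rprod (I : choiceType) (G : groupType) : Type :=
  {fsfun I -> G with 1}.

HB.instance Definition _ (I : choiceType) (G : groupType) :=
  Choice.on (rprod I G).

Section RestrictedProduct.
Variables (I : choiceType) (G : groupType).
Local Notation P := {fsfun I -> G with 1}.
Implicit Types f g h : P.

Definition rprod_one : P := [fsfun].
Definition rprod_mul f g : P :=
  [fsfun i in (finsupp f `|` finsupp g)%fset => f i * g i].
Definition rprod_inv f : P := [fsfun i in finsupp f => (f i)^-1].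

Lemma rprod_oneE i : rprod_one i = 1.
Proof. by rewrite fsfunE. Qed.

Lemma rprod_mulE f g i : rprod_mul f g i = f i * g i.
Proof.
rewrite fsfunE in_fsetU; case: ifP => // /norP[fi gi].
by rewrite !fsfun_dflt // mulg1.
Qed.

Lemma rprod_invE f i : rprod_inv f i = (f i)^-1.
Proof. by rewrite fsfunE; case: ifPn => // fi; rewrite fsfun_dflt // invg1. Qed.

Fact rprod_mulA : associative rprod_mul.
Proof. by move=> f g h; apply/fsfunP => i; rewrite !rprod_mulE mulgA. Qed.
Fact rprod_mul1 : left_id rprod_one rprod_mul.
Proof. by move=> f; apply/fsfunP => i; rewrite rprod_mulE rprod_oneE mul1g. Qed.
Fact rprod_1mul : right_id rprod_one rprod_mul.
Proof. by move=> f; apply/fsfunP => i; rewrite rprod_mulE rprod_oneE mulg1. Qed.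
Fact rprod_mulV : left_inverse rprod_one rprod_inv rprod_mul.
Proof.
by move=> f; apply/fsfunP => i; rewrite rprod_mulE rprod_invE rprod_oneE mulVg.
Qed.
Fact rprod_Vmul : right_inverse rprod_one rprod_inv rprod_mul.
Proof.
by move=> f; apply/fsfunP => i; rewrite rprod_mulE rprod_invE rprod_oneE mulgV.
Qed.

HB.instance Definition _ := isGroup.Build (rprod I G)
  rprod_mulA rprod_mul1 rprod_1mul rprod_mulV rprod_Vmul.

End RestrictedProduct.

(* Right actions of a possibly infinite group; MathComp's [action] requires
   the group to be finite. *)
Record group_action (U : groupType) (I : Type) := GroupAction {
  gact :> I -> U -> I;
  gact1 : forall i, gact i 1 = i;
  gactM : forall i u v, gact i (u * v) = gact (gact i u) v
}.

(* Restricted permutational wreath product.  The pair (f, u) stands for the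
   product f u, and f ^ u has value f i at coordinate i ^ u; hence
   (f u)(g v) = (f (g ^ u^-1)) (u v), where g ^ u^-1 has value g (i ^ u) at i. *)
Definition pwreath (A U : groupType) (I : choiceType)
  (to : group_action U I) : Type := (rprod I A * U)%type.

HB.instance Definition _ (A U : groupType) (I : choiceType)
  (to : group_action U I) := Choice.on (pwreath A to).

Section Wreath.
Variables (A U : groupType) (I : choiceType) (to : group_action U I).
Local Notation W := (rprod I A * U)%type.
Local Notation P := {fsfun I -> A with 1}.

Definition rprod_shift (g : P) (u : U) : P :=
  [fsfun i in [fset to j u^-1 | j in finsupp g]%fset => g (to i u)].

Lemma rprod_shiftE (g : P) u i : rprod_shift g u i = g (to i u).
Proof.
rewrite fsfunE; case: ifPn => // /imfsetP gi.
rewrite fsfun_dflt //; apply/negP => giu; apply: gi; exists (to i u) => //.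
by rewrite -gactM mulgV gact1.
Qed.

Definition pwreath_one : W := (1, 1).
Definition pwreath_mul (x y : W) : W :=
  (x.1 * (rprod_shift y.1 x.2 : rprod I A), x.2 * y.2).
Definition pwreath_inv (x : W) : W :=
  ((rprod_shift x.1 x.2^-1 : rprod I A)^-1, x.2^-1).

Let E1 i : (1 : rprod I A) i = 1 := rprod_oneE A i.
Let EM (f g : rprod I A) i : (f * g) i = f i * g i := rprod_mulE f g i.
Let EV (f : rprod I A) i : f^-1 i = (f i)^-1 := rprod_invE f i.

Fact pwreath_mulA : associative pwreath_mul.
Proof.
move=> x y z; rewrite /pwreath_mul /= !mulgA; congr pair.
by apply/fsfunP => i; rewrite !(EM, rprod_shiftE) gactM mulgA.
Qed.
Fact pwreath_mul1 : left_id pwreath_one pwreath_mul.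
Proof.
move=> [f u]; rewrite /pwreath_mul /pwreath_one /=.
congr pair; last exact: mul1g.
by apply/fsfunP => i; rewrite !(EM, E1, rprod_shiftE) gact1 mul1g.
Qed.
Fact pwreath_1mul : right_id pwreath_one pwreath_mul.
Proof.
move=> [f u]; rewrite /pwreath_mul /pwreath_one /=.
congr pair; last exact: mulg1.
by apply/fsfunP => i; rewrite !(EM, E1, rprod_shiftE) mulg1.
Qed.
Fact pwreath_mulV : left_inverse pwreath_one pwreath_inv pwreath_mul.
Proof.
move=> [f u]; rewrite /pwreath_mul /pwreath_one /=.
congr pair; last exact: mulVg.
by apply/fsfunP => i; rewrite !(EM, E1, EV, rprod_shiftE) mulVg.
Qed.
Fact pwreath_Vmul : right_inverse pwreath_one pwreath_inv pwreath_mul.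
Proof.
move=> [f u]; rewrite /pwreath_mul /pwreath_one /=.
congr pair; last exact: mulgV.
apply/fsfunP => i; rewrite !(EM, E1, EV, rprod_shiftE).
by rewrite -gactM mulgV gact1 mulgV.
Qed.

HB.instance Definition _ := isGroup.Build (pwreath A to)
  pwreath_mulA pwreath_mul1 pwreath_1mul pwreath_mulV pwreath_Vmul.

End Wreath.

Definition regular_action (U : groupType) : group_action U U :=
  @GroupAction U U (fun x u => x * u) (@mulg1 U) (@mulgA U).

Definition wreath (A U : groupType) : groupType :=
  pwreath A (regular_action U).

Section PermWreath.
Variables (s : nat) (K : {group 'S_s}).

Fact perm_act1 (i : 'I_s) : sgval (1 : subg_of K) i = i.
Proof. by rewrite perm1. Qed.
Fact perm_actM (i : 'I_s) (k l : subg_of K) :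
  sgval (k * l) i = sgval l (sgval k i).
Proof. by rewrite permM. Qed.

Definition coord_action : group_action (subg_of K) 'I_s :=
  @GroupAction (subg_of K) 'I_s (fun i k => sgval k i) perm_act1 perm_actM.

End PermWreath.

(* G^s ><| K with K permuting the s coordinates: the index set ['I_s] being
   finite, the restricted product is the full G^s. *)
Definition perm_wreath (G : groupType) (s : nat) (K : {group 'S_s}) :
  groupType := pwreath G (coord_action K).

Definition regular_perm_group (s : nat) (K : {group 'S_s}) : Prop :=
  [transitive K, on [set: 'I_s] | 'P] /\ forall i : 'I_s, 'C_K[i | 'P] = 1.

Definition Zgrp : groupType := Algebra.to_multiplicative int.
Definition C2grp : groupType := Algebra.to_multiplicative 'Z_2.

(* Main.v *)
From HB Require Import structures.
From mathcomp Require Import all_boot all_fingroup all_algebra.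
From mathcomp Require Import finmap zify.
From mathcomp Require Import boolp classical_sets cardinality.
Require Import Defs.

Set Implicit Arguments.
Unset Strict Implicit.
Unset Printing Implicit Defensive.

Import GroupScope.

(** A state-closed representation of G is a recursion: every g moves each
    letter y to a letter y.g, and below y it acts as another element of G, the
    state of g at y.  Letters form a G-set and the states satisfy the cocycle
    identity (gh)_y = g_y h_(y.g).  Conversely any such data ([self_action])
    defines a state-closed representation ([tree_rep]), and a faithful
    state-closed representation comes from such data ([rep_self_action]).  So
    each part reduces to writing down a cocycle and showing that an element
    acting trivially on all strings is trivial.  An element g has finitely many
    states as soon as a finite set containing g is stable under taking states
    ([finitary]).

    For the restricted power, add to the alphabet of G one fixed letter.  Below
    an old letter only coordinate 0 acts, as it does in G; below the new letter
    acts the sequence shifted by one.  If f acts trivially then so does f 0 in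
    G, and the shifts of f act trivially as well, so f = 1
    ([power_faithful]).  The new letter is an orbit of its own
    ([orbit_type_lift]).  For the integers one starts from the binary adding
    machine.

    For the wreath product G wr K with K transitive on the coordinates, let
    Y_1, ..., Y_s be the orbits of letters and take as letters the pairs (y, k)
    with y in Y_1 x ... x Y_s and k in K.  They are the cosets of
    H_1 x ... x H_s, where H_i is the stabiliser in G of a point of Y_i.  The
    state of (g, v) at (y, k) lies in the base group, with i-th coordinate the
    state of g (i^k) at y_i.  If (g, v) acts trivially then v = 1; and since k
    is arbitrary, each coordinate of g can be brought in front of each orbit
    Y_i, so each coordinate of g acts trivially on all strings of letters
    ([wreath_faithful]).  A regular K has s elements, which gives the degree
    m_1 ... m_s s.

    The degree 4 representation of (Z wr Z) wr C_2 applies this construction to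
    a representation of Z wr Z with orbits of sizes 2 and 1.  Think of Z wr Z
    as the pairs (p, u) with p a finitely supported function on Z and u a
    translation of Z.  On the two letters 0 and 1, u acts as the adding
    machine, and p is split into its values at even and at odd positions.
    Below the third letter (p, u) acts as the translation by the sum of the
    values of p.  An element acting trivially has u = 1, hence p has sum 0, and
    so has every function obtained by repeated splitting; but the support
    shrinks until it is a single point, so p = 0 ([zwrz_faithful]). *)

(** * State-closed representations from cocycles *)

(** A recursive description of an action of G on strings: [srest y g] is the
    element of G that acts as the state of g at y. *)
Record self_action (G : groupType) (Y : Type) := SelfAction {
  sact : Y -> G -> Y;
  srest : Y -> G -> G;
  sact1 : forall y, sact y 1 = y;
  sactM : forall y g h, sact y (g * h) = sact (sact y g) h;
  srestM : forall y g h, srest y (g * h) = srest y g * srest (sact y g) h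
}.

Section TreeRep.
Variables (G : groupType) (Y : Type) (S : self_action G Y).

Lemma srest1 y : srest S y 1 = 1.
Proof.
have := srestM S y 1 1; rewrite mulg1 sact1 => h.
by apply: (mulgI (srest S y 1)); rewrite mulg1 -h.
Qed.

Fixpoint tree_act (g : G) (u : seq Y) : seq Y :=
  if u is y :: v then sact S y g :: tree_act (srest S y g) v else [::].

Lemma tree_act1 u : tree_act 1 u = u.
Proof. by elim: u => //= y u IH; rewrite sact1 srest1 IH. Qed.

Lemma tree_actM g h u : tree_act (g * h) u = tree_act h (tree_act g u).
Proof. by elim: u g h => //= y u IH g h; rewrite sactM srestM IH. Qed.

Lemma tree_act_id g y : tree_act g =1 id ->
  sact S y g = y /\ tree_act (srest S y g) =1 id.
Proof.
by move=> g1; split=> [|u]; [have [] := g1 [:: y] | have [] := g1 (y :: u)].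
Qed.

Fact tree_actK g : cancel (tree_act g) (tree_act g^-1).
Proof. by move=> u; rewrite -tree_actM mulgV tree_act1. Qed.

Fact tree_actVK g : cancel (tree_act g^-1) (tree_act g).
Proof. by move=> u; rewrite -tree_actM mulVg tree_act1. Qed.

Lemma tree_act_edge1 g u v :
  tree_edge u v -> tree_edge (tree_act g u) (tree_act g v).
Proof.
move=> [y ->]; elim: u g => [|x u IH] g /=; first by exists (sact S y g).
by have [z ->] := IH (srest S x g); exists z.
Qed.

Fact tree_act_edge g u v :
  tree_edge u v <-> tree_edge (tree_act g u) (tree_act g v).
Proof.
split; first exact: tree_act_edge1.
by move/(@tree_act_edge1 g^-1); rewrite !tree_actK.
Qed.

Definition tree_rep (g : G) : tree_aut Y :=
  TreeAut (tree_actK g) (tree_actVK g) (erefl _) (tree_act_edge g).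

Fact tree_repM : {morph tree_rep : g h / g * h}.
Proof. by move=> g h; apply: tree_autP => u; exact: tree_actM. Qed.

HB.instance Definition _ := isMultiplicative.Build G (tree_aut Y)
  tree_rep tree_repM.

Lemma level1_tree_rep g y : level1 (tree_rep g) y = sact S y g.
Proof. by []. Qed.

Lemma state_tree_rep g y : state (tree_rep g) y = tree_rep (srest S y g).
Proof. exact: tree_autP. Qed.

(** Used twice: the full group Q gives state-closedness of the image, a finite Q
    gives finitely many states. *)
Lemma tree_rep_state_closed (Q : G -> Prop) g b :
    Q g -> (forall y h, Q h -> Q (srest S y h)) ->
  is_state (tree_rep g) b -> exists2 h, Q h & b = tree_rep h.
Proof.
move=> Qg Qrest; elim=> [|{}b y _ [h Qh ->]]; first by exists g.
by exists (srest S y h); [exact: Qrest | exact: state_tree_rep].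
Qed.

(** Triviality of the kernel, stated on strings so that it can be proved by
    induction on them. *)
Definition faithful_action := forall g, tree_act g =1 id -> g = 1.

(** A criterion for every [tree_rep S g] to be finite-state that avoids
    enumerating states: they all come from the finite stable set Q. *)
Definition finitary := forall g, exists Q : set G,
  [/\ finite_set Q, Q g & forall y h, Q h -> Q (srest S y h)].

End TreeRep.

Section Reps.
Variables (G : groupType) (Y : finType) (S : self_action G Y).

Lemma tree_rep_faithful : faithful_action S ->
  faithful_state_closed_rep (tree_rep S : {multiplicative G -> tree_aut Y}).
Proof.
move=> S_faithful; split.
  move=> g h eq_gh; apply: (mulIg h^-1); rewrite mulgV; apply: S_faithful => u.
  by rewrite tree_actM -[RHS](tree_actK S h) -[tree_act S g u]/(tree_rep S g u)
             eq_gh.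
move=> _ [g _ <-] b gb.
have [//|//|h _ ->] := tree_rep_state_closed (Q := fun=> True) _ _ gb.
by exists h.
Qed.

Lemma tree_rep_finite_state : finitary S ->
  finite_state_rep (tree_rep S : {multiplicative G -> tree_aut Y}).
Proof.
move=> S_fin g; have [Q [Qfin Qg Qrest]] := S_fin g.
apply: sub_finite_set (finite_image (tree_rep S) Qfin) => b.
by move=> gb; have [h Qh ->] := tree_rep_state_closed Qg Qrest gb; exists h.
Qed.

End Reps.

Section Transport.
Variables (G : groupType) (Y Y' : Type) (S : self_action G Y).
Variables (f : Y -> Y') (f' : Y' -> Y) (fK : cancel f f') (f'K : cancel f' f).

Let act y g := f (sact S (f' y) g).
Let rest y g := srest S (f' y) g.

Fact relabel_act1 y : act y 1 = y.
Proof. by rewrite /act sact1. Qed.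
Fact relabel_actM y g h : act y (g * h) = act (act y g) h.
Proof. by rewrite /act fK sactM. Qed.
Fact relabel_restM y g h : rest y (g * h) = rest y g * rest (act y g) h.
Proof. by rewrite /rest /act fK srestM. Qed.

Definition relabel_action :=
  SelfAction relabel_act1 relabel_actM relabel_restM.

Lemma relabel_tree_act g u :
  tree_act relabel_action g (map f u) = map f (tree_act S g u).
Proof. by elim: u g => //= y u IH g; rewrite /act /rest fK IH. Qed.

Lemma relabel_faithful : faithful_action S -> faithful_action relabel_action.
Proof.
move=> S_faithful g g1; apply: S_faithful => u.
by apply: (inj_map (can_inj fK)); rewrite -relabel_tree_act g1.
Qed.

Lemma relabel_finitary : finitary S -> finitary relabel_action.
Proof.
move=> S_fin g; have [Q [Qfin Qg Qr]] := S_fin g; exists Q; split=> // y h.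
exact: Qr.
Qed.

End Transport.

(** Since the image of rho contains its states, each state of rho g is rho h for
    some h; since rho is injective, h is unique, and the cocycle identity for
    these h follows from the one for states of tree automorphisms. *)
Lemma rep_self_action (G : groupType) (Y : finType)
    (rho : {multiplicative G -> tree_aut Y}) :
    faithful_state_closed_rep rho ->
  exists2 S : self_action G Y, faithful_action S &
    forall g y, sact S y g = level1 (rho g) y.
Proof.
move=> [rho_inj rho_sc].
have rho1 : rho 1 = 1 by apply: (mulgI (rho 1)); rewrite -gmulfM !mulg1.
have restP (yg : Y * G) : exists h, rho h = state (rho yg.2) yg.1.
  case: yg => y g; have st : is_state (rho g) (state (rho g) y).
    exact/is_state_step/is_state_refl.
  by have [|h _ <-] := rho_sc (rho g) _ _ st; [exists g | exists h].
have [r rE] := choice restP.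
pose act y g := level1 (rho g) y.
have act1 y : act y 1 = y by rewrite /act rho1.
have actM y g h : act y (g * h) = act (act y g) h.
  rewrite /act gmulfM {1}/level1 -[(rho g * rho h) _]/(rho h (rho g [:: y])).
  by rewrite [rho g _]autE autE.
have restM y g h : r (y, g * h) = r (y, g) * r (act y g, h).
  apply: rho_inj; rewrite gmulfM !rE /= gmulfM; apply: tree_autP => u.
  rewrite -[RHS]/(state_fun (rho h) (act y g) (state_fun (rho g) y u)).
  rewrite -[LHS]/(behead (rho h (rho g (y :: u)))).
  by rewrite [rho g _]autE autE.
pose S := SelfAction (srest := fun y g => r (y, g)) act1 actM restM.
exists S => // g g1; apply: rho_inj; rewrite rho1; apply: tree_autP => u.
rewrite -[RHS]g1; elim: u g {g1} => [|y u IH] g; first exact: aut_root.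
by rewrite autE /= -IH rE.
Qed.

(** * Finitely supported functions *)

Section RestrictedProductFacts.
Variables (I : choiceType) (G : groupType).
Implicit Types f g : rprod I G.

Lemma rprod_val1 (i : I) : (1 : rprod I G) i = 1.
Proof. exact: rprod_oneE. Qed.

Lemma rprod_valM f g (i : I) : (f * g) i = f i * g i.
Proof. exact: rprod_mulE. Qed.

Lemma rprodP f g : (forall i, f i = g i) -> f = g.
Proof. by move=> fg; apply/fsfunP. Qed.

Definition rprod_of (D : {fset I}) (e : I -> G) : rprod I G :=
  [fsfun i in D => e i].

Lemma rprod_ofE (D : {fset I}) (e : I -> G) :
  (forall i, i \notin D -> e i = 1) -> forall i, rprod_of D e i = e i.
Proof. by move=> eD i; rewrite fsfunE; case: ifPn => // /eD. Qed.

(** Such functions are images of functions between two finite types. *)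
Lemma finite_rprod (D : {fset I}) (F : set G) : finite_set F ->
  finite_set [set f : rprod I G |
    (forall i, i \notin D -> f i = 1) /\ forall i, F (f i)]%classic.
Proof.
move=> Ffin; pose X := fset_set F.
pose mk (e : {ffun D -> X}) : rprod I G :=
  rprod_of D (fun i => if insub i is Some d then val (e d) else 1).
apply: sub_finite_set (finite_image mk (finite_finset (X := setT))).
move=> f [fD fF].
have fX i : f i \in X by rewrite in_fset_set // inE; exact: fF.
exists [ffun d : D => [` fX (val d)]%fset] => //; apply: rprodP => i.
rewrite fsfunE; case: ifPn => [iD | /fD -> //].
by rewrite insubT ffunE.
Qed.

End RestrictedProductFacts.

(** Finitely many elements of G have together finitely many states, so the
    values of f lie in a finite stable set.  It contains 1 to allow for the
    coordinates outside the support. *)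
Lemma finitary_values (I : choiceType) (G : groupType) (Y : Type)
    (S : self_action G Y) (f : rprod I G) : finitary S ->
  exists F : set G, [/\ finite_set F, F 1, forall i, F (f i)
    & forall y h, F h -> F (srest S y h)].
Proof.
move=> S_fin; have [Q QP] := choice S_fin.
have QF g : Q g g by have [] := QP g.
pose D : {fset G} := (1%g |` [fset f i | i in finsupp f])%fset.
exists (\bigcup_(g in [set` D]) Q g)%classic; split.
- by apply: bigcup_finite => // g _; have [] := QP g.
- by exists 1; rewrite //= !inE eqxx.
- move=> i; exists (f i) => //=; rewrite !inE; case: eqVneq => //= fi.
  by apply/imfsetP; exists i => //=; rewrite mem_finsupp.
- by move=> y h [g gD gh]; exists g => //; have [_ _] := QP g; apply.
Qed.

(** * The restricted power: one additional fixed letter *)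

Section RestrictedPower.
Variables (G : groupType) (Y : Type) (S : self_action G Y).
Local Notation P := (rprod nat G).

Definition single (g : G) : P :=
  rprod_of [fset 0%N]%fset (fun i => if i is 0 then g else 1).

Lemma singleE g i : single g i = if i is 0 then g else 1.
Proof. by apply: rprod_ofE => -[|j //]; rewrite in_fset1 eqxx. Qed.

Definition shift (f : P) : P :=
  rprod_of [fset i.-1 | i in finsupp f]%fset (fun i => f i.+1).

Lemma shiftE f i : shift f i = f i.+1.
Proof.
apply: rprod_ofE => {}i /imfsetP fi; apply/fsfun_dflt/negP => i1f.
by apply: fi; exists i.+1.
Qed.

(** The letter [None] is the additional one: it is fixed, and below it acts the
    shifted sequence. *)
Definition power_act (y : option Y) (f : P) : option Y :=
  omap (fun x => sact S x (f 0%N)) y.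

Definition power_rest (y : option Y) (f : P) : P :=
  if y is Some x then single (srest S x (f 0%N)) else shift f.

Fact power_act1 y : power_act y 1 = y.
Proof. by case: y => //= y; rewrite rprod_val1 sact1. Qed.

Fact power_actM y f g : power_act y (f * g) = power_act (power_act y f) g.
Proof. by case: y => //= y; rewrite rprod_valM sactM. Qed.

Fact power_restM y f g :
  power_rest y (f * g) = power_rest y f * power_rest (power_act y f) g.
Proof.
apply: rprodP => i; rewrite rprod_valM; case: y => [y|] /=.
  by rewrite !singleE; case: i => [|i]; rewrite ?mulg1 // rprod_valM srestM.
by rewrite !shiftE rprod_valM.
Qed.

Definition power_action := SelfAction power_act1 power_actM power_restM.

Lemma power_single_tree_act g u :
  tree_act power_action (single g) (map some u) = map some (tree_act S g u).
Proof. by elim: u g => //= y u IH g; rewrite singleE IH. Qed.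

(** Coordinate 0 is seen directly on strings of old letters, and coordinate i
    after i passages through the additional letter. *)
Lemma power_faithful : faithful_action S -> faithful_action power_action.
Proof.
move=> S_faithful.
have f0 f : tree_act power_action f =1 id -> f 0%N = 1.
  move=> f1; apply: S_faithful => -[//|y u].
  have := f1 (map some (y :: u)); rewrite /= power_single_tree_act => -[-> fu].
  by congr cons; apply: (inj_map (@Some_inj _)).
move=> f f1; apply: rprodP => i; rewrite rprod_val1.
elim: i f f1 => [|i IH] f f1; first exact: f0.
by rewrite -shiftE IH // => u; have [] := f1 (None :: u).
Qed.

(** Taking states moves the support down and keeps the values in a finite stable
    set, so the sequences with bounded support and such values form a finite
    stable set. *)
Lemma power_finitary : finitary S -> finitary power_action.
Proof.
move=> S_fin f; have [F [Ffin F1 Ff Frest]] := finitary_values f S_fin.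
pose n := (\max_(i <- finsupp f) i.+1)%N.
have fn i : (n <= i)%N -> f i = 1.
  move=> ni; apply/fsfun_dflt/negP => fi.
  have := leq_trans (leq_bigmax_seq i (F := fun j => j.+1) fi isT) ni.
  by rewrite ltnn.
exists [set h : P | (forall i, (n <= i)%N -> h i = 1)
                 /\ forall i, F (h i)]%classic.
split.
- apply: sub_finite_set (finite_rprod (seq_fset tt (iota 0 n)) Ffin).
  move=> h [hn hF]; split=> // i; rewrite seq_fsetE mem_iota add0n -leqNgt.
  exact: hn.
- by split.
- move=> [y|] h [hn hF]; split=> i /=.
  + rewrite singleE; case: i => // n0.
    by rewrite hn // srest1.
  + by rewrite singleE; case: i => // ; exact: Frest.
  + by move=> ni; rewrite shiftE hn // leqW.
  + by rewrite shiftE.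
Qed.

End RestrictedPower.

(** * Orbits on the first level *)

Section Level1Orbits.
Variables (G : groupType) (Y : finType).
Variable rho : {multiplicative G -> tree_aut Y}.

Definition level1_orbit y : {set Y} := orbit 'P (level1_image rho) y.

Lemma level1_orbitP y z :
  reflect (exists g, level1 (rho g) y = z) (z \in level1_orbit y).
Proof.
apply: (iffP imsetP) => [[p]|[g <-]].
  by rewrite inE => /asboolP[g <-] ->; exists g; rewrite /= apermE permE.
by exists (sigma (rho g)); [rewrite inE; apply/asboolP; exists g
                          | rewrite /= apermE permE].
Qed.

Lemma level1_orbitsE : level1_orbits rho = level1_orbit @: [set: Y]%SET.
Proof. by []. Qed.

Lemma size_level1_orbits (ms : seq nat) :
  orbit_type rho ms -> #|level1_orbits rho| = size ms.
Proof. by move=> /perm_size; rewrite size_map -cardE. Qed.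

End Level1Orbits.

(** rho' has the first-level behaviour of rho on the letters different from
    [ord_max], for a possibly different group, and fixes [ord_max]. *)
Section AddedFixedLetter.
Variables (G H : groupType) (m : nat).
Variable rho : {multiplicative G -> tree_aut 'I_m}.
Variable rho' : {multiplicative H -> tree_aut 'I_m.+1}.

Local Notation emb := (lift (@ord_max m)).

Hypothesis rho_rho' : forall g y,
  exists h, level1 (rho' h) (emb y) = emb (level1 (rho g) y).
Hypothesis rho'_rho : forall h y,
  exists g, level1 (rho' h) (emb y) = emb (level1 (rho g) y).
Hypothesis rho'_max : forall h, level1 (rho' h) ord_max = ord_max.

Lemma level1_orbit_lift y :
  level1_orbit rho' (emb y) = emb @: level1_orbit rho y.
Proof.
apply/setP => z; apply/level1_orbitP/imsetP.
  move=> [h <-].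
  have [g ->] := rho'_rho h y; exists (level1 (rho g) y) => //.
  by apply/level1_orbitP; exists g.
move=> [_ /level1_orbitP[g <-] ->].
by have [h <-] := rho_rho' g y; exists h.
Qed.

Lemma level1_orbit_max : level1_orbit rho' ord_max = [set ord_max].
Proof.
apply/setP => z; rewrite inE; apply/level1_orbitP/eqP => [[h <-]|->].
  exact: rho'_max.
by exists 1.
Qed.

Lemma orbit_type_lift ms : orbit_type rho ms -> orbit_type rho' (rcons ms 1%N).
Proof.
move=> ms_type; pose E (B : {set 'I_m}) := emb @: B.
have E_inj : injective E by apply: imset_inj; exact: lift_inj.
have maxNE : [set ord_max] \notin E @: level1_orbits rho.
  apply/imsetP => -[B _ /setP/(_ ord_max)]; rewrite inE eqxx => /esym/imsetP.
  by case=> y _ /eqP; rewrite (negPf (neq_lift _ _)).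
have orbE : level1_orbits rho' = [set ord_max] |: (E @: level1_orbits rho).
  rewrite !level1_orbitsE; apply/setP => B; apply/imsetP/setU1P.
    case=> y _ ->; have [z ->|->] := unliftP ord_max y.
      by right; rewrite level1_orbit_lift; apply/imset_f/imset_f.
    by left; exact: level1_orbit_max.
  case=> [->|/imsetP[_ /imsetP[y _ ->] ->]].
    by exists ord_max; rewrite ?level1_orbit_max.
  by exists (emb y); rewrite ?level1_orbit_lift.
rewrite /orbit_type perm_sym perm_rcons perm_sym.
have enumE : perm_eq (enum (level1_orbits rho'))
    ([set ord_max] :: map E (enum (level1_orbits rho))).
  apply: uniq_perm; first exact: enum_uniq.
    rewrite /= map_inj_uniq ?enum_uniq // andbT.
    apply: contra maxNE => /mapP[B]; rewrite mem_enum => BO ->.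
    exact: imset_f.
  move=> B; rewrite mem_enum orbE in_setU1 inE; congr orb.
  apply/imsetP/mapP => -[C]; rewrite ?mem_enum => CO ->;
    by exists C; rewrite ?mem_enum.
apply: perm_trans (perm_map _ enumE) _; rewrite /= cards1 perm_cons -map_comp.
rewrite (eq_map (g := fun B : {set 'I_m} => #|B|)) // => B /=.
by rewrite card_imset //; exact: lift_inj.
Qed.

End AddedFixedLetter.

Section RestrictedPowerRep.
Variables (G : groupType) (m : nat) (S : self_action G 'I_m).

Let enc (y : option 'I_m) : 'I_m.+1 :=
  if y is Some x then lift ord_max x else ord_max.
Fact power_letterK : cancel enc (unlift ord_max).
Proof. by case=> [y|] /=; rewrite ?liftK ?unlift_none. Qed.
Fact power_letterVK : cancel (unlift ord_max) enc.
Proof. by move=> y; case: unliftP => [z ->|->]. Qed.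

Definition power_rep :=
  tree_rep (relabel_action (power_action S) power_letterK power_letterVK).

Lemma power_rep_faithful : faithful_action S ->
  faithful_state_closed_rep
    (power_rep : {multiplicative rprod nat G -> tree_aut 'I_m.+1}).
Proof.
by move=> S1; apply/tree_rep_faithful/relabel_faithful/power_faithful.
Qed.

Lemma power_rep_finite_state : finitary S ->
  finite_state_rep
    (power_rep : {multiplicative rprod nat G -> tree_aut 'I_m.+1}).
Proof.
by move=> S1; apply/tree_rep_finite_state/relabel_finitary/power_finitary.
Qed.

Lemma power_rep_orbit_type (rho : {multiplicative G -> tree_aut 'I_m}) ms :
    (forall g y, sact S y g = level1 (rho g) y) -> orbit_type rho ms ->
  orbit_type (power_rep : {multiplicative rprod nat G -> tree_aut 'I_m.+1})
    (rcons ms 1%N).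
Proof.
move=> rhoE; apply: orbit_type_lift => [g y|f y|f].
- exists (single g); rewrite level1_tree_rep /= liftK /= singleE rhoE //.
- exists (f 0%N); rewrite level1_tree_rep /= liftK /= rhoE //.
- by rewrite level1_tree_rep /= unlift_none.
Qed.

End RestrictedPowerRep.

Lemma self_similar_rprod (G : groupType) (m : nat) (ms : seq nat) :
  self_similar G m ms -> self_similar (rprod nat G) m.+1 (rcons ms 1%N).
Proof.
move=> [rho [rho_faithful rho_type]].
have [S S_faithful rhoE] := rep_self_action rho_faithful.
exists (power_rep S : {multiplicative _ -> _}); split.
  exact: power_rep_faithful.
exact: power_rep_orbit_type rhoE rho_type.
Qed.

(** * Wreath products *)

Section Wreath.
Variables (G U : groupType) (I : choiceType) (to : group_action U I).
Variables (Y : Type) (S : self_action G Y) (B : I -> pred Y).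
Hypothesis B_act : forall i y g, B i y -> B i (sact S y g).

Local Notation W := (pwreath G to).
(** The predicate [B i] is the orbit, or any union of orbits, of letters that
    stands at coordinate i.  U acts on its own component of a letter by right
    translation, which makes it free there. *)
Definition wreath_letter : Type := ((forall i, {y : Y | B i y}) * U)%type.
Implicit Types (a : wreath_letter) (x z : W).

Definition wreath_act a x : wreath_letter :=
  (fun i => exist _ (sact S (sval (a.1 i)) (x.1 (to i a.2)))
                    (B_act (x.1 (to i a.2)) (svalP (a.1 i))),
   a.2 * x.2).

Definition wreath_rest a x : W :=
  (rprod_of [fset to j a.2^-1 | j in finsupp x.1]%fset
     (fun i => srest S (sval (a.1 i)) (x.1 (to i a.2))), 1).

Lemma wreath_restE a x i :
  (wreath_rest a x).1 i = srest S (sval (a.1 i)) (x.1 (to i a.2)).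
Proof.
apply: rprod_ofE => {}i /imfsetP xi; rewrite fsfun_dflt ?srest1 //.
apply/negP => ix; apply: xi; exists (to i a.2) => //.
by rewrite -gactM mulgV gact1.
Qed.

Lemma wreath_val1 i : (1 : W).1 i = 1.
Proof. exact: rprod_val1. Qed.

Lemma wreath_valM x z i : (x * z).1 i = x.1 i * z.1 (to i x.2).
Proof. by rewrite [LHS]rprod_valM rprod_shiftE. Qed.

Lemma wreath_letterP a b :
  (forall i, sval (a.1 i) = sval (b.1 i)) -> a.2 = b.2 -> a = b.
Proof.
case: a b => [y k] [z l] /= yz ->; congr pair.
by apply: functional_extensionality_dep => i; apply: val_inj; exact: yz.
Qed.

Fact wreath_act1 a : wreath_act a 1 = a.
Proof.
by apply: wreath_letterP => [i|] /=; rewrite ?wreath_val1 ?sact1 ?mulg1.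
Qed.

Fact wreath_actM a x z : wreath_act a (x * z) = wreath_act (wreath_act a x) z.
Proof.
apply: wreath_letterP => [i|] /=; last exact: mulgA.
by rewrite wreath_valM sactM -gactM.
Qed.

Fact wreath_restM a x z :
  wreath_rest a (x * z) = wreath_rest a x * wreath_rest (wreath_act a x) z.
Proof.
apply: injective_projections; last by rewrite /= mulg1.
apply: rprodP => i; rewrite wreath_valM !wreath_restE wreath_valM srestM /=.
by rewrite gact1 gactM.
Qed.

Definition wreath_action := SelfAction wreath_act1 wreath_actM wreath_restM.

Hypothesis B_inh : forall i, exists y, B i y.
Hypothesis B_cover : forall y, exists i, B i y.
Hypothesis to_trans : forall i j, exists k, to i k = j.

(** By induction on strings, each coordinate of an element x of the kernel acts
    trivially in G.  A letter y of the string lies in some [B i]; to reach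
    coordinate j of x through it, choose k moving i to j and a letter (q, k)
    with q i = y.  The state of x at (q, k) is again in the kernel, and its
    coordinate i is the state at y of coordinate j of x. *)
Lemma wreath_faithful : faithful_action S -> faithful_action wreath_action.
Proof.
move=> S_faithful x x1.
have pt : exists y : forall i, {y : Y | B i y}, True.
  suff [y _] : {y : forall i, {y : Y | B i y} & True} by exists y.
  by exists (fun i => let: exist y yB := cid (B_inh i) in exist _ y yB).
apply: injective_projections; last first.
  by case: pt => y _; have [_] := x1 [:: (y, 1)]; rewrite mul1g.
apply: rprodP => j; rewrite wreath_val1; apply: S_faithful => u.
elim: u x x1 j => //= y u IH x x1 j.
have [i yB] := B_cover y; have [k <-] := to_trans i j.
case: pt => p _.
pose q : forall i', {y : Y | B i' y} := fun i' =>
  if pselect (i = i') is left e then exist _ y (ecast i (B i y) e yB) else p i'.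
have qi : sval (q i) = y.
  by rewrite /q; case: pselect => // e; rewrite (Prop_irrelevance e erefl).
have xq w : tree_act wreath_action x ((q, k) :: w) = (q, k) :: w by exact: x1.
have [/(congr1 (fun h : forall i, {y : Y | B i y} => sval (h i))) /= + _] :=
  xq [::].
rewrite qi => ->; congr cons.
rewrite -{1}qi -[k]/((q, k).2) -[q i]/((q, k).1 i) -wreath_restE.
by apply: IH => w; have [] := xq w.
Qed.

Lemma wreath_finitary (I_fin : finite_set [set: I])
    (U_fin : finite_set [set: U]) :
  finitary S -> finitary wreath_action.
Proof.
move=> S_fin x.
have [F [Ffin F1 xF Frest]] := finitary_values x.1 S_fin.
exists ([set f : rprod I G | forall i, F (f i)] `*` setT)%classic; split=> //.
  apply: finite_setX => //.
  apply: sub_finite_set (finite_rprod (fset_set [set: I]) Ffin) => f Ff.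
  by split=> // i; rewrite in_fset_set // in_setT.
move=> a z [zF _]; split=> // i; rewrite wreath_restE; exact/Frest/zF.
Qed.

End Wreath.

(** * The binary adding machine *)

Section IntegersModTwo.

Definition parity (n : int) : 'I_2 := inord `|(n %% 2)%Z|%N.

Lemma parityE n : Posz (parity n) = (n %% 2)%Z.
Proof. by rewrite inordK; lia. Qed.

Lemma parity_eq (y : 'I_2) n : Posz y = (n %% 2)%Z -> y = parity n.
Proof. by move=> yn; apply: val_inj; have := parityE n; rewrite -yn => -[]. Qed.

Lemma finite_int_interval (N : nat) :
  finite_set [set z : int | (`|z| <= N)%N]%classic.
Proof.
pose s := [seq (Posz i - Posz N)%R | i <- iota 0 (N + N).+1].
apply: sub_finite_set (finite_seq s) => z; rewrite /mkset => zN.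
apply/mapP; exists `|(z + Posz N)%R|%N; rewrite ?mem_iota; lia.
Qed.

End IntegersModTwo.

(** The group law of [Zgrp], written in the ring of integers, where arithmetic
    can be decided. *)
Lemma Zgrp_mulE (a b : Zgrp) : @eq int (a * b) (a + b)%R.
Proof. by []. Qed.
Lemma Zgrp_oneE : @eq int (1 : Zgrp) 0%R.
Proof. by []. Qed.

Section AddingMachine.
Implicit Types (y : 'I_2) (m n : Zgrp).

(** Write y + n = 2 q + r with r in {0, 1}: the integer n moves the letter y to
    r and its state at y, the carry, is q.  This is addition of n on binary
    expansions, least significant digit first. *)
Definition adding_act (y : 'I_2) (n : Zgrp) : 'I_2 :=
  parity (Posz y + n)%R.
Definition adding_rest (y : 'I_2) (n : Zgrp) : Zgrp :=
  ((Posz y + n) %/ 2)%Z.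

Lemma adding_actE y n :
  Posz (adding_act y n) = ((Posz y + n) %% 2)%Z.
Proof. exact: parityE. Qed.

Lemma adding_eq y n :
  @eq int (Posz y + n)%R (adding_rest y n * 2 + Posz (adding_act y n))%R.
Proof. by rewrite adding_actE /adding_rest; lia. Qed.

Fact adding_act1 y : adding_act y 1 = y.
Proof.
by apply/esym/parity_eq; rewrite Zgrp_oneE; have := ltn_ord y; lia.
Qed.

Fact adding_actM y m n : adding_act y (m * n) = adding_act (adding_act y m) n.
Proof.
by apply: parity_eq; rewrite !adding_actE Zgrp_mulE; lia.
Qed.

Fact adding_restM y m n :
  adding_rest y (m * n) = adding_rest y m * adding_rest (adding_act y m) n.
Proof.
rewrite /adding_rest !Zgrp_mulE adding_actE; lia.
Qed.

Definition adding_machine := SelfAction adding_act1 adding_actM adding_restM.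

(** An integer in the kernel is even and its half is in the kernel. *)
Lemma adding_machine_faithful : faithful_action adding_machine.
Proof.
move=> n; have [N] := ubnP `|n|%N; elim: N n => // N IH n nN n1.
have [/= a0 r0] := tree_act_id ord0 n1.
have := adding_eq ord0 n; rewrite a0 /= => nE.
have [n0 | n0] := eqVneq (n : int) 0%R; first exact: n0.
have : adding_rest ord0 n = 1 by apply: IH => //; lia.
by rewrite Zgrp_oneE => r1; rewrite r1 in nE; lia.
Qed.

(** Halving does not increase absolute values, up to the carry y, which is
    harmless as soon as the bound is at least 1. *)
Lemma adding_machine_finitary : finitary adding_machine.
Proof.
move=> n; exists [set z : int | (`|z| <= `|(n : int)|.+1)%N]%classic.
split=> /=.
- exact: finite_int_interval.
- lia.
- move=> y h hn; rewrite /adding_rest; have := ltn_ord y; lia.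
Qed.

End AddingMachine.

(** * The wreath product of two infinite cyclic groups *)

Section ZWreathZ.
Local Notation P := (rprod Zgrp Zgrp).
Local Notation W := (wreath Zgrp Zgrp).
Implicit Types (f : P) (x z : W) (y : 'I_2) (a : option 'I_2).

Definition total f : Zgrp := (\sum_(i <- finsupp f) (f i : int))%R.

Lemma totalE (D : {fset int}) f : (forall i : int, i \notin D -> f i = 1) ->
  total f = (\sum_(i <- D) (f i : int))%R.
Proof.
move=> fD; apply: big_fset_incl.
  apply/fsubsetP => i; apply: contraLR => /fD fi.
  by rewrite mem_finsupp fi eqxx.
by move=> i _ iN; rewrite fsfun_dflt.
Qed.

Lemma totalM f g : total (f * g) = total f * total g.
Proof.
have sub D (h : P) : (finsupp h `<=` D)%fset ->
    forall i : Zgrp, i \notin D -> h i = 1.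
  by move=> /fsubsetP hD i iD; apply: fsfun_dflt; apply: contra iD; exact: hD.
pose D := (finsupp f `|` finsupp g)%fset.
have fD := sub D f (fsubsetUl _ _); have gD := sub D g (fsubsetUr _ _).
have fgD (i : int) : i \notin D -> (f * g) i = 1.
  by move=> iD; rewrite rprod_valM fD ?gD ?mulg1.
rewrite (totalE fD) (totalE gD) (totalE fgD) Zgrp_mulE -big_split /=.
by apply: eq_bigr => i _; rewrite rprod_valM.
Qed.

Lemma total_shift f (g : P) (u : Zgrp) :
  (forall i, g i = f (i * u)) -> total g = total f.
Proof.
move=> gf; pose D := [fset (i - u)%R | i in finsupp f]%fset.
rewrite (@totalE D) => [|i iD].
  rewrite big_imfset /= => [|i j _ _ /= /GRing.addIr //].
  by apply: eq_bigr => i _; rewrite gf Zgrp_mulE GRing.subrK.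
rewrite gf; apply: fsfun_dflt; apply: contra iD => iu.
by apply/imfsetP; exists (i + u)%R; rewrite //= GRing.addrK.
Qed.

Definition deinterleave y f : P :=
  rprod_of [fset ((j - Posz y)%R %/ 2)%Z | j in finsupp f]%fset
    (fun i : int => f (i * 2 + Posz y)%R).

Lemma deinterleaveE y f (i : int) : deinterleave y f i = f (i * 2 + Posz y)%R.
Proof.
apply: (@rprod_ofE _ _ _ (fun i : int => f (i * 2 + Posz y)%R)) => {}i iD.
apply: fsfun_dflt; apply: contra iD => fi; apply/imfsetP.
by exists (i * 2 + Posz y)%R => //=; lia.
Qed.

(** The virtual endomorphisms behind this recursion are: on the pairs (p, u)
    with u even, take the even part of p and halve u; on the whole group, send
    (p, u) to the translation by the sum of p.  The latter is a homomorphism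
    because the sum is invariant under translations ([total_shift]). *)
Definition zwrz_act a x : option 'I_2 :=
  omap (fun y => adding_act y x.2) a.

Definition zwrz_rest a x : W :=
  if a is Some y then (deinterleave y x.1, adding_rest y x.2)
  else (1, total x.1).

Fact zwrz_act1 a : zwrz_act a 1 = a.
Proof. by case: a => //= y; rewrite adding_act1. Qed.

Fact zwrz_actM a x z : zwrz_act a (x * z) = zwrz_act (zwrz_act a x) z.
Proof. by case: a => //= y; rewrite adding_actM. Qed.

Fact zwrz_restM a x z :
  zwrz_rest a (x * z) = zwrz_rest a x * zwrz_rest (zwrz_act a x) z.
Proof.
case: a => [y|] /=; apply: injective_projections => //=.
- apply: rprodP => i; rewrite [RHS]rprod_valM rprod_shiftE !deinterleaveE.
  rewrite [LHS]wreath_valM; congr (_ * z.1 _).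
  by rewrite /= !Zgrp_mulE GRing.mulrDl -!GRing.addrA (adding_eq y x.2).
- exact: adding_restM.
- by rewrite mul1g; apply: rprodP => i; rewrite rprod_shiftE !rprod_val1.
- rewrite totalM; congr (_ * _).
  by apply: (@total_shift _ _ x.2) => i; rewrite rprod_shiftE.
Qed.

Definition zwrz_action := SelfAction zwrz_act1 zwrz_actM zwrz_restM.

Lemma zwrz_tree_act x v :
  tree_act zwrz_action x (map some v) =
  map some (tree_act adding_machine x.2 v).
Proof. by elim: v x => //= y v IH x; rewrite IH. Qed.

Lemma support_bound f : exists n : nat, forall i : int, (n < `|i|)%N -> f i = 1.
Proof.
exists (\max_(i <- finsupp f) `|(i : int)|)%N => i ni; apply: fsfun_dflt.
apply/negP => fi; move: ni; rewrite ltnNge => /negP; apply.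
exact: (leq_bigmax_seq i (F := fun j : int => `|j|%N)).
Qed.

Lemma value_bound f : exists n : nat, forall i : int, (`|(f i : int)| <= n)%N.
Proof.
exists (\max_(i <- finsupp f) `|(f i : int)|)%N => i.
have [fi|fi] := boolP (i \in finsupp f); last by rewrite fsfun_dflt.
exact: (leq_bigmax_seq i (F := fun j : int => `|(f j : int)|%N)).
Qed.

Lemma total_eq1 f (c : int) :
  (forall i : int, i != c -> f i = 1) -> total f = 1 -> f = 1.
Proof.
move=> fc f1; apply: rprodP => i; rewrite rprod_val1.
have [->|/fc //] := eqVneq i c.
rewrite -[RHS]f1 (@totalE [fset c]%fset) ?big_seq_fset1 // => j.
by rewrite in_fset1 => /fc.
Qed.

(** The translation part is killed by the faithful adding machine.  For the
    function part, splitting roughly halves the support, and the sum of each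
    piece vanishes because it occurs as a translation in the kernel.  A function
    supported at one point is determined by its sum. *)
Lemma zwrz_faithful : faithful_action zwrz_action.
Proof.
have snd1 x : tree_act zwrz_action x =1 id -> x.2 = 1.
  move=> x1; apply: adding_machine_faithful => v.
  by apply: (inj_map (@Some_inj _)); rewrite -zwrz_tree_act x1.
suff fst1 n x : tree_act zwrz_action x =1 id ->
    (forall i : int, (i < - n%:R - 1)%R || (n%:R < i)%R -> x.1 i = 1) ->
    x.1 = 1.
  move=> x x1; apply: injective_projections; last exact: snd1.
  have [n xn] := support_bound x.1.
  by apply: (fst1 n) => // i ni; apply: xn; lia.
(* The interval from -n-1 to n is chosen because dividing positions by 2 with
   either remainder maps it into the interval for n %/ 2.  For n = 0 it
   is {-1, 0}, and each half then lives at the one position -y. *)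
have [N] := ubnP n; elim: N n x => // N IH n x nN x1 xn.
have half y : deinterleave y x.1 = 1.
  have [_ /= y1] := tree_act_id (Some y) x1.
  case: n nN xn => [|n] nN xn; last first.
    apply: (IH (n.+1)./2 _ _ y1) => [|i ni /=]; first by lia.
    by rewrite deinterleaveE; apply: xn; have := ltn_ord y; lia.
  apply: (total_eq1 (c := (- Posz y)%R)) => [i iy|].
    by rewrite deinterleaveE; apply: xn; have := ltn_ord y; lia.
  by have [_ /snd1] := tree_act_id None y1.
apply: rprodP => j; rewrite rprod_val1.
have : deinterleave (parity j) x.1 (j %/ 2)%Z = 1 by rewrite half rprod_val1.
by rewrite deinterleaveE parityE -divz_eq.
Qed.

Lemma sum_bound (s : seq int) (F : int -> int) (n : nat) :
  (forall i, `|F i| <= n)%N -> (`|(\sum_(i <- s) F i)%R| <= size s * n)%N.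
Proof.
move=> Fn; elim: s => [|i s IH]; first by rewrite big_nil.
rewrite big_cons /= mulSn; have := Fn i; move: IH (F i).
by move: (bigop _ _ _) (size s * n)%N => a b; lia.
Qed.

(** Supports and values stay bounded under splitting, by n and m.  Translations
    are halved or come from a sum of at most #|D| values, whence the bound L;
    the summand 1 in L absorbs the carry. *)
Lemma zwrz_finitary : finitary zwrz_action.
Proof.
move=> x; have [n xn] := support_bound x.1; have [m xm] := value_bound x.1.
have Dfin := finite_int_interval n.
pose D := fset_set [set z : int | (`|z| <= n)%N]%classic.
have DP (i : int) : (i \notin D) = (n < `|i|)%N.
  by rewrite in_fset_set // ltnNge; congr negb; apply/idP/idP; rewrite inE.
pose L := (size D * m + `|(x.2 : int)| + 1)%N.
pose F := [set f : P | (forall i : int, i \notin D -> f i = 1)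
                    /\ forall i : int, (`|(f i : int)| <= m)%N]%classic.
exists (F `*` [set v : int | (`|v| <= L)%N])%classic; split.
- apply: finite_setX; last exact: finite_int_interval.
  exact: (@finite_rprod Zgrp Zgrp D _ (finite_int_interval m)).
- split; last by rewrite /= /L addn1 leqW // leq_addl.
  by split=> // i; rewrite DP; exact: xn.
- move=> [y|] [f u] [[/= fD fm] uL]; split=> /=.
  + split=> i; rewrite deinterleaveE // DP => ni.
    by apply: fD; rewrite DP; have := ltn_ord y; lia.
  + by rewrite /adding_rest; have := ltn_ord y; lia.
  + by split=> i; rewrite rprod_val1.
  + by rewrite (totalE fD) (leq_trans (sum_bound D fm)) // /L -addnA leq_addr.
Qed.
End ZWreathZ.

(** * Degrees and orbit-types *)

(** Counts the letters of the wreath product.  V is a finite copy of U: the type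
    of a group need not come with an enumeration. *)
Lemma wreath_letter_code (I Y V : finType) (U : groupType) (B : I -> pred Y)
    (e : U -> V) (e' : V -> U) (n : nat) :
    cancel e e' -> cancel e' e -> (\prod_i #|[pred y | B i y]| * #|V| = n)%N ->
  exists (f : wreath_letter U B -> 'I_n) (f' : 'I_n -> wreath_letter U B),
    cancel f f' /\ cancel f' f.
Proof.
move=> eK e'K nE; pose T := ({dffun forall i, {y : Y | B i y}} * V)%type.
have TE : #|{: T}| = n.
  rewrite card_prod card_dep_ffun -nE; congr muln.
  rewrite foldrE big_map -big_enum; apply: eq_bigr => i _; exact: card_sig.
pose enc (a : wreath_letter U B) : T :=
  ([ffun i => a.1 i] : {dffun forall i, {y : Y | B i y}}, e a.2).
exists (fun a => cast_ord TE (enum_rank (enc a))).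
exists (fun j => let t := enum_val (cast_ord (esym TE) j) : T in
                 (fun i => t.1 i, e' t.2)).
split=> [[y k]|j].
  rewrite /= cast_ordK enum_rankK /= eK; congr pair.
  by apply: functional_extensionality_dep => i; rewrite ffunE.
apply: (canLR (cast_ordKV TE)); rewrite /enc /= e'K.
rewrite -[RHS]enum_valK; congr enum_rank.
by case: (enum_val _) => t k /=; congr pair; apply/ffunP => i; rewrite ffunE.
Qed.

Section WreathRep.
Variables (G U : groupType) (I Y V : finType) (to : group_action U I).
Variables (S : self_action G Y) (B : I -> pred Y).
Variables (e : U -> V) (e' : V -> U) (n : nat).
Hypotheses (eK : cancel e e') (e'K : cancel e' e).
Hypothesis B_act : forall i y g, B i y -> B i (sact S y g).
Hypothesis B_inh : forall i, exists y, B i y.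
Hypothesis B_cover : forall y, exists i, B i y.
Hypothesis to_trans : forall i j, exists k, to i k = j.
Hypothesis nE : (\prod_i #|[pred y | B i y]| * #|V| = n)%N.

Lemma wreath_rep : faithful_action S ->
  exists rho : {multiplicative pwreath G to -> tree_aut 'I_n},
    faithful_state_closed_rep rho /\ (finitary S -> finite_state_rep rho).
Proof.
move=> S_faithful; have [f [f' [fK f'K]]] := wreath_letter_code eK e'K nE.
exists (tree_rep (relabel_action (wreath_action to B_act) fK f'K)
  : {multiplicative _ -> _}); split.
  exact/tree_rep_faithful/relabel_faithful/wreath_faithful.
have U_fin : finite_set [set: U]%classic.
  rewrite (_ : setT = e' @` setT)%classic; first exact: finite_image.
  by apply/seteqP; split=> // u _; exists (e u).
move=> S_fin; apply/tree_rep_finite_state/relabel_finitary.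
apply: wreath_finitary => //.
exact: finite_finset.
Qed.

End WreathRep.

(** The letter y is moved to z by z - y. *)
Lemma adding_machine_orbit_type :
  orbit_type (tree_rep adding_machine : {multiplicative Zgrp -> tree_aut 'I_2})
    [:: 2%N].
Proof.
set rho := (X in orbit_type X).
have orbT y : level1_orbit rho y = [set: 'I_2]%SET.
  apply/setP => z; rewrite inE; apply/level1_orbitP.
  exists (Posz z - Posz y)%R; rewrite level1_tree_rep /= /adding_act.
  by apply/esym/parity_eq; have := ltn_ord z; lia.
have orbsE : level1_orbits rho = [set [set: 'I_2]%SET]%SET.
  apply/setP => B; rewrite level1_orbitsE inE; apply/imsetP/eqP.
    by move=> [y _ ->]; exact: orbT.
  by move=> ->; exists ord0; rewrite ?orbT.
by rewrite /orbit_type orbsE enum_set1 /= cardsT card_ord.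
Qed.

Lemma card_regular_perm_group (s : nat) (K : {group 'S_s}) :
  regular_perm_group K -> #|K| = s.
Proof.
move=> [K_trans K_free]; have [i _ _] := imsetP K_trans.
have := card_orbit_stab 'P K i.
by rewrite (atransP K_trans) ?inE // cardsT card_ord K_free cards1 muln1.
Qed.

Lemma self_similar_perm_wreath (G : groupType) (m s : nat) (ms : s.-tuple nat)
    (K : {group 'S_s}) : self_similar G m ms -> regular_perm_group K ->
  exists rho : {multiplicative perm_wreath G K ->
                  tree_aut 'I_((\prod_(i < s) tnth ms i) * s)},
    faithful_state_closed_rep rho.
Proof.
move=> [rho0 [rho0_faithful rho0_type]] K_reg.
have [S S_faithful rho0E] := rep_self_action rho0_faithful.
pose O := enum (level1_orbits rho0).
have Os : size O = s.
  by rewrite -cardE (size_level1_orbits rho0_type) size_tuple.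
(* The orbit-type lists sizes in any order, so coordinate i gets the i-th orbit
   of some enumeration; only the product of the sizes matters. *)
pose B (i : 'I_s) : pred 'I_m := fun y => y \in nth finset.set0 O i.
have BP (i : 'I_s) : exists y0, nth finset.set0 O i = level1_orbit rho0 y0.
  have : nth finset.set0 O i \in O by rewrite mem_nth // Os ltn_ord.
  by rewrite mem_enum level1_orbitsE => /imsetP[y0 _ ->]; exists y0.
have B_act i y g : B i y -> B i (sact S y g).
  rewrite /B; have [y0 ->] := BP i; move=> /level1_orbitP[h <-].
  by apply/level1_orbitP; exists (h * g); rewrite -!rho0E sactM.
have orbit_self y : y \in level1_orbit rho0 y.
  by apply/level1_orbitP; exists 1; rewrite -rho0E sact1.
have B_inh i : exists y, B i y.
  by rewrite /B; have [y0 ->] := BP i; exists y0; exact: orbit_self.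
have B_cover y : exists i, B i y.
  have yO : level1_orbit rho0 y \in O.
    by rewrite mem_enum level1_orbitsE; exact: imset_f.
  have ys : (index (level1_orbit rho0 y) O < s)%N by rewrite -Os index_mem.
  by exists (Ordinal ys); rewrite /B nth_index // orbit_self.
have to_trans i j : exists k, coord_action K i k = j.
  have [K_trans _] := K_reg.
  have : j \in orbit 'P K i by rewrite (atransP K_trans) inE.
  by case/imsetP => k kK ->; exists (subg K k); rewrite /= subgK.
have nE : (\prod_i #|[pred y | B i y]| * #|{: subg_of K}|
           = (\prod_(i < s) tnth ms i) * s)%N.
  rewrite card_sub (card_regular_perm_group K_reg); congr muln.
  rewrite -(big_tuple _ _ ms predT id) -(perm_big _ rho0_type) /= big_map.
  rewrite (big_nth finset.set0) big_mkord Os; apply: eq_bigr => i _.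
  by apply: fintype.eq_card.
have [rho [rho_faithful _]] := wreath_rep (e := id) (frefl id) (frefl id)
  B_act B_inh B_cover to_trans nE S_faithful.
by exists rho.
Qed.

Lemma zwrz_wreath_C2 :
  exists rho : {multiplicative wreath (wreath Zgrp Zgrp) C2grp ->
                  tree_aut 'I_4},
    faithful_state_closed_rep rho /\ finite_state_rep rho.
Proof.
(* Coordinate 0 carries the fixed letter, coordinate 1 the orbit of size 2. *)
pose B (i : 'Z_2) : pred (option 'I_2) := fun y => (y == None) == (i == ord0).
have B_act i y g : B i y -> B i (sact zwrz_action y g) by case: y.
have B_inh i : exists y, B i y.
  by have [i0|i0] := eqVneq i ord0; [exists None | exists (Some ord0)];
    rewrite /B ?i0 // (negPf i0).
have B_cover y : exists i, B i y.
  by case: y => [y|]; [exists ord_max | exists ord0].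
have to_trans i j : exists k, regular_action C2grp i k = j.
  by exists (i^-1 * j); rewrite /= mulgA mulgV mul1g.
have nE : (\prod_i #|[pred y | B i y]| * #|'Z_2| = 4)%N.
  rewrite !big_ord_recl big_ord0 card_ord.
  rewrite (_ : #|_| = 1)%N; last first.
    by rewrite (@fintype.eq_card1 _ None) // => -[].
  rewrite (_ : #|_| = 2)%N //.
  rewrite -[RHS](card_ord 2) -[RHS](fintype.card_codom (@Some_inj _)).
  apply: fintype.eq_card => -[y|]; rewrite !inE /=; apply/esym.
    exact: codom_f.
  by apply/negP => /codomP[].
have [rho [rho_faithful rho_fin]] := wreath_rep (U := C2grp) (V := 'Z_2)
  (e := id) (frefl id) (frefl id) B_act B_inh B_cover to_trans nE zwrz_faithful.
by exists rho; split=> //; exact/rho_fin/zwrz_finitary.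
Qed.

Theorem theoremB (G : groupType) (m s : nat) (ms : s.-tuple nat)
    (hm : (0 < m)%N) (hG : self_similar G m ms) :
  (* 1 *)
  (self_similar (rprod nat G) m.+1 (rcons ms 1%N) /\
   exists rho : {multiplicative rprod nat Zgrp -> tree_aut 'I_3},
     [/\ faithful_state_closed_rep rho, orbit_type rho [:: 2; 1]%N
       & finite_state_rep rho]) /\
  (* 2 *)
  ((forall K : {group 'S_s}, regular_perm_group K ->
     exists rho : {multiplicative perm_wreath G K ->
                     tree_aut 'I_((\prod_(i < s) tnth ms i) * s)},
       faithful_state_closed_rep rho) /\
   exists rho : {multiplicative wreath (wreath Zgrp Zgrp) C2grp ->
                   tree_aut 'I_4},
     faithful_state_closed_rep rho /\ finite_state_rep rho).
Proof.
split; split; first exact: self_similar_rprod.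
- exists (power_rep adding_machine : {multiplicative _ -> _}); split.
  + exact/power_rep_faithful/adding_machine_faithful.
  + apply: (power_rep_orbit_type (ms := [:: 2%N]) _ adding_machine_orbit_type).
    by move=> g y; rewrite level1_tree_rep.
  + exact/power_rep_finite_state/adding_machine_finitary.
- by move=> K K_reg; exact: self_similar_perm_wreath hG K_reg.
- exact: zwrz_wreath_C2.
Qed.
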